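(* Let $\Delta$ be an irreducible reduced root system not of type $A_n$, with positive roots $\Delta^+$, simple roots $\Pi$ and highest root $\theta$, and let $\lfloor\theta/2\rfloor=\sum_{\alpha\in\Pi}\lfloor\mathrm{ht}_\alpha(\theta)/2\rfloor\alpha$. Then $\lfloor\theta/2\rfloor$ is a root, it is the unique maximal element of $\Delta^+_{\sf nc}$ with respect to $\preccurlyeq$, and $\lfloor\theta/2\rfloor\in\mathcal H$.
   Context: For $\mu=\sum_{\alpha\in\Pi}c_\alpha\alpha$, $\mathrm{ht}_\alpha(\mu)=c_\alpha$; $\mu\preccurlyeq\nu$ iff $\nu-\mu$ is a non-negative integral combination of simple roots. A subset $I\subset\Delta^+$ is abelian if $\gamma'+\gamma''\notin\Delta^+$ for all $\gamma',\gamma''\in I$. $\Delta^+_{\sf nc}$ is the set of $\gamma\in\Delta^+$ for which the upper ideal $\{\nu\in\Delta^+\mid\nu\succcurlyeq\gamma\}$ is not abelian. $\mathcal H=\{\gamma\in\Delta^+\mid(\gamma,\theta)>0\}$ (the Heisenberg ideal), where $(\ ,\ )$ is a $W$-invariant inner product. *)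

(* Defs.v *)
From HB Require Import structures.
From mathcomp Require Import all_boot all_order all_algebra all_fingroup.
From mathcomp Require Import reals.
Set Implicit Arguments. Unset Strict Implicit. Unset Printing Implicit Defensive.
Import Order.TTheory GRing.Theory Num.Theory.
Local Open Scope ring_scope.

Section RootSystems.
Variable R : realType.
Variable n : nat.
Local Notation V := 'rV[R]_n.

Definition dot (u v : V) : R := (u *m v^T) 0 0.

Definition cartan (b a : V) : R := 2 * dot b a / dot a a.

Definition refl (a b : V) : V := b - cartan b a *: a.

Definition is_intR (x : R) : Prop := exists z : int, x = z%:~R.

Definition is_root_system (Phi : seq V) : Prop :=
  [/\ 0 \notin Phi,
      (<<Phi>>%VS = fullv),
      (forall a b, a \in Phi -> b \in Phi -> refl a b \in Phi) &
      (forall a b, a \in Phi -> b \in Phi -> is_intR (cartan b a))].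

Definition is_reduced (Phi : seq V) : Prop :=
  forall a (c : R), a \in Phi -> c *: a \in Phi -> c = 1 \/ c = -1.

Definition is_irreducible (Phi : seq V) : Prop :=
  Phi <> [::] /\
  forall P : pred V,
    (forall a b, a \in Phi -> b \in Phi -> P a -> ~~ P b -> dot a b = 0) ->
    (forall a, a \in Phi -> P a) \/ (forall a, a \in Phi -> ~~ P a).

(* simple-root coordinates w.r.t. the basis whose rows are the rows of B:
   ht B i mu = ht_{alpha_i}(mu), where alpha_i = row i B *)
Definition ht (B : 'M[R]_n) (i : 'I_n) (mu : V) : R := (mu *m invmx B) 0 i.

Definition is_base (Phi : seq V) (B : 'M[R]_n) : Prop :=
  [/\ B \in unitmx,
      (forall i, row i B \in Phi) &
      (forall a, a \in Phi ->
         (forall i, is_intR (ht B i a)) /\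
         ((forall i, 0 <= ht B i a) \/ (forall i, ht B i a <= 0)))].

Definition pos_root (Phi : seq V) (B : 'M[R]_n) (a : V) : Prop :=
  a \in Phi /\ forall i, 0 <= ht B i a.

Definition preceq (B : 'M[R]_n) (mu nu : V) : Prop :=
  forall i, exists k : nat, ht B i nu - ht B i mu = k%:R.

Definition is_highest_root (Phi : seq V) (B : 'M[R]_n) (theta : V) : Prop :=
  pos_root Phi B theta /\ forall a, a \in Phi -> preceq B a theta.

Definition typeA (B : 'M[R]_n) : Prop :=
  exists s : 'S_n, forall i j : 'I_n,
    cartan (row (s i) B) (row (s j) B) =
      if i == j then 2
      else if (i.+1 == j :> nat) || (j.+1 == i :> nat) then -1 else 0.

Definition half_floor (B : 'M[R]_n) (theta : V) : V :=
  \sum_(i < n) ((Num.floor (ht B i theta / 2))%:~R : R) *: row i B.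

Definition abelian_set (Phi : seq V) (B : 'M[R]_n) (I : V -> Prop) : Prop :=
  forall g g', I g -> I g' -> ~ pos_root Phi B (g + g').

Definition upper_ideal (Phi : seq V) (B : 'M[R]_n) (g : V) : V -> Prop :=
  fun nu => pos_root Phi B nu /\ preceq B g nu.

Definition nc_root (Phi : seq V) (B : 'M[R]_n) (g : V) : Prop :=
  pos_root Phi B g /\ ~ abelian_set Phi B (upper_ideal Phi B g).

Definition heis (Phi : seq V) (B : 'M[R]_n) (theta g : V) : Prop :=
  pos_root Phi B g /\ 0 < dot g theta.

End RootSystems.

(* Main.v *)
Require Import Defs.
From HB Require Import structures.
From mathcomp Require Import all_boot all_order all_algebra all_fingroup.
From mathcomp Require Import reals ring lra zify.
Import Order.TTheory GRing.Theory Num.Theory.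
Local Open Scope ring_scope.

(* Two roots above a root g with sum a root give 2g <= theta, hence
   g <= [theta/2]; so it suffices that mu = [theta/2] is a root with
   (mu, theta) > 0, since then theta - mu is also a root above mu.
   Write theta = sum m_i alpha_i; then sum m_i (alpha_i, theta^v) = 2, and
   outside type A exactly one simple root alpha_0 is not orthogonal to theta,
   with m_0 = 2.  Starting from alpha_0, add simple roots to a root g as long as
   2g <= theta.  When this stops, delta = theta - 2g satisfies
   (delta, alpha_i) <= 0 whenever its coefficient d_i is at least 2.  As the sum
   of the simple roots in the support of delta is never longer than delta, all
   d_i are at most 1, that is, g = mu. *)

(** * The inner product and Cartan numbers *)

Section InnerProduct.
Set Implicit Arguments.
Unset Strict Implicit.
Variables (R : realType) (n : nat).
Implicit Types u v w : 'rV[R]_n.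

Lemma dotE u v : dot u v = \sum_i u 0 i * v 0 i.
Proof. by rewrite /dot mxE; apply: eq_bigr => i _; rewrite mxE. Qed.

Lemma dotC u v : dot u v = dot v u.
Proof. by rewrite !dotE; apply: eq_bigr => i _; rewrite mulrC. Qed.

Lemma dotDl u v w : dot (u + v) w = dot u w + dot v w.
Proof. by rewrite /dot mulmxDl mxE. Qed.

Lemma dotZl c u w : dot (c *: u) w = c * dot u w.
Proof. by rewrite /dot -scalemxAl mxE. Qed.

Lemma dotNl u w : dot (- u) w = - dot u w.
Proof. by rewrite /dot mulNmx mxE. Qed.

Lemma dotDr u v w : dot w (u + v) = dot w u + dot w v.
Proof. by rewrite !(dotC w) dotDl. Qed.

Lemma dotZr c u w : dot w (c *: u) = c * dot w u.
Proof. by rewrite !(dotC w) dotZl. Qed.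

Lemma dotNr u w : dot w (- u) = - dot w u.
Proof. by rewrite !(dotC w) dotNl. Qed.

Lemma dot0l w : dot 0 w = 0.
Proof. by rewrite /dot mul0mx mxE. Qed.

Lemma dot_suml (I : Type) (r : seq I) (P : pred I) (F : I -> 'rV[R]_n) w :
  dot (\sum_(i <- r | P i) F i) w = \sum_(i <- r | P i) dot (F i) w.
Proof. by rewrite /dot mulmx_suml summxE. Qed.

Definition dot_lin := (dotDl, dotDr, dotNl, dotNr, dotZl, dotZr).

Lemma dot_ge0 u : 0 <= dot u u.
Proof. by rewrite dotE; apply: sumr_ge0 => i _; rewrite -expr2 sqr_ge0. Qed.

Lemma dot_eq0 u : (dot u u == 0) = (u == 0).
Proof.
apply/eqP/eqP => [|->]; last by rewrite dot0l.
rewrite dotE => /eqP; rewrite psumr_eq0; last by move=> i _; rewrite -expr2 sqr_ge0.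
move=> /allP h; apply/rowP => i; rewrite mxE; apply/eqP.
by have := h i (mem_index_enum i); rewrite /= mulf_eq0 orbb.
Qed.

Lemma dot_gt0 u : (0 < dot u u) = (u != 0).
Proof. by rewrite lt_def dot_ge0 andbT dot_eq0. Qed.

Lemma intr_gt0_ge1 (x : R) : x \is a Num.int -> 0 < x -> 1 <= x.
Proof. by move=> /intrP[z ->]; rewrite ltr0z ler1z gtz0_ge1. Qed.

Lemma is_intRP (x : R) : is_intR x -> x \is a Num.int.
Proof. by move=> [z ->]; rewrite intr_int. Qed.

Lemma cartanDl u v w : cartan (u + v) w = cartan u w + cartan v w.
Proof. by rewrite /cartan dotDl mulrDr mulrDl. Qed.

Lemma cartan_id u : u != 0 -> cartan u u = 2.
Proof. by rewrite -dot_eq0 /cartan => ?; rewrite mulfK. Qed.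

Lemma cartan_suml (I : Type) (r : seq I) (P : pred I) (F : I -> 'rV[R]_n) w :
  cartan (\sum_(i <- r | P i) F i) w = \sum_(i <- r | P i) cartan (F i) w.
Proof. by rewrite /cartan dot_suml mulr_sumr mulr_suml. Qed.

Lemma cartanZl c u w : cartan (c *: u) w = c * cartan u w.
Proof. by rewrite /cartan dotZl; ring. Qed.

Lemma dot_cartan u v : v != 0 -> 2 * dot u v = cartan u v * dot v v.
Proof. by rewrite -dot_eq0 /cartan => ?; rewrite divfK. Qed.

Lemma cartan_gt0 u v : v != 0 -> (0 < cartan u v) = (0 < dot u v).
Proof.
rewrite -dot_gt0 /cartan => v0.
by rewrite pmulr_lgt0 ?invr_gt0// pmulr_rgt0.
Qed.

Lemma cartan_lt0 u v : v != 0 -> (cartan u v < 0) = (dot u v < 0).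
Proof.
rewrite -dot_gt0 /cartan => v0.
by rewrite pmulr_llt0 ?invr_gt0// pmulr_rlt0.
Qed.

Lemma cartan_eq0 u v : v != 0 -> (cartan u v == 0) = (dot u v == 0).
Proof.
rewrite -dot_eq0 /cartan => v0.
by rewrite !mulf_eq0 invr_eq0 (negbTE v0) pnatr_eq0 orbF.
Qed.

End InnerProduct.

(** * Differences and sums of roots *)

Section Roots.
Set Implicit Arguments.
Unset Strict Implicit.
Variables (R : realType) (n : nat) (Phi : seq 'rV[R]_n).
Hypothesis PhiRS : is_root_system Phi.
Implicit Types a b : 'rV[R]_n.

Lemma root_neq0 a : a \in Phi -> a != 0.
Proof. by case: PhiRS => h _ _ _ aP; apply: contraNneq h => <-. Qed.

Lemma root_refl a b : a \in Phi -> b \in Phi -> refl a b \in Phi.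
Proof. by case: PhiRS => _ _ h _; apply: h. Qed.

Lemma root_int a b : a \in Phi -> b \in Phi -> cartan b a \is a Num.int.
Proof. by case: PhiRS => _ _ _ h aP bP; apply/is_intRP/h. Qed.

Lemma root_opp a : a \in Phi -> - a \in Phi.
Proof.
move=> aP; have := root_refl aP aP; rewrite /refl cartan_id ?root_neq0//.
by rewrite scaler_nat mulr2n opprD addNKr.
Qed.

(** Both Cartan integers are positive. If one of them is 1, a reflection yields [a - b] up to
    sign. *)
Lemma root_sub a b : a \in Phi -> b \in Phi -> 0 < dot a b -> a != b ->
  a - b \in Phi.
Proof.
move=> aP bP ab_gt0 ab.
have [a0 b0] := (root_neq0 aP, root_neq0 bP).
have k1 : 1 <= cartan a b by rewrite intr_gt0_ge1 ?root_int ?cartan_gt0.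
have l1 : 1 <= cartan b a by rewrite intr_gt0_ge1 ?root_int ?cartan_gt0 // dotC.
have [k|k] := eqVneq (cartan a b) 1.
  by have := root_refl bP aP; rewrite /refl k scale1r.
have [l|l] := eqVneq (cartan b a) 1.
  by have := root_opp (root_refl aP bP); rewrite /refl l scale1r opprB.
(* Both Cartan integers are at least 2, so [|a - b|^2 <= 0]. *)
have k2 : 1 <= cartan a b - 1.
  by rewrite intr_gt0_ge1 ?rpredB ?root_int ?rpred1// subr_gt0 lt_neqAle eq_sym k.
have l2 : 1 <= cartan b a - 1.
  by rewrite intr_gt0_ge1 ?rpredB ?root_int ?rpred1// subr_gt0 lt_neqAle eq_sym l.
have := dot_cartan a b0; have := dot_cartan b a0.
have := dot_ge0 a; have := dot_ge0 b.
rewrite (dotC b a) => b_ge0 a_ge0 e1 e2.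
have : 0 < dot (a - b) (a - b) by rewrite dot_gt0 subr_eq0.
rewrite !dot_lin (dotC b a); nra.
Qed.

Lemma root_add a b : a \in Phi -> b \in Phi -> dot a b < 0 -> a != - b ->
  a + b \in Phi.
Proof.
move=> aP bP ab ne; rewrite -[b]opprK; apply: root_sub => //.
  exact: root_opp.
by rewrite dotNr oppr_gt0.
Qed.

End Roots.

(** * Coordinates with respect to a base *)

Section Base.
Set Implicit Arguments.
Unset Strict Implicit.
Variables (R : realType) (n : nat) (Phi : seq 'rV[R]_n) (B : 'M[R]_n).
Hypotheses (PhiRS : is_root_system Phi) (PhiB : is_base Phi B).
Implicit Types (a b v : 'rV[R]_n) (i j k : 'I_n) (d : 'I_n -> nat).

(** Coefficients are kept in [nat] to allow induction on their sum and halving. *)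
Definition natcomb d : 'rV[R]_n := \sum_i (d i)%:R *: row i B.

Lemma htD i u v : ht B i (u + v) = ht B i u + ht B i v.
Proof. by rewrite /ht mulmxDl mxE. Qed.

Lemma htN i v : ht B i (- v) = - ht B i v.
Proof. by rewrite /ht mulNmx mxE. Qed.

Lemma htZ i c v : ht B i (c *: v) = c * ht B i v.
Proof. by rewrite /ht -scalemxAl mxE. Qed.

Lemma ht_sum (I : Type) (r : seq I) (P : pred I) (F : I -> 'rV[R]_n) i :
  ht B i (\sum_(j <- r | P j) F j) = \sum_(j <- r | P j) ht B i (F j).
Proof. by rewrite /ht mulmx_suml summxE. Qed.

Lemma ht_row i j : ht B i (row j B) = (i == j)%:R.
Proof.
case: PhiB => Bu _ _.
by rewrite /ht -row_mul mulmxV// row1 mxE eqxx /= eq_sym.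
Qed.

Lemma ht_inj u v : (forall i, ht B i u = ht B i v) -> u = v.
Proof.
case: PhiB => Bu _ _ h; rewrite -(mulmxKV Bu u) -(mulmxKV Bu v).
by congr (_ *m B); apply/rowP => i; apply: h.
Qed.

Lemma ht_natcomb i d : ht B i (natcomb d) = (d i)%:R.
Proof.
rewrite ht_sum (bigD1 i)//= big1 => [|j ji].
  by rewrite htZ ht_row eqxx mulr1 addr0.
by rewrite htZ ht_row eq_sym (negbTE ji) mulr0.
Qed.

Lemma natcomb_ext d d' : d =1 d' -> natcomb d = natcomb d'.
Proof. by move=> h; apply: eq_bigr => i _; rewrite h. Qed.

Lemma natcombD d d' : natcomb (fun i => d i + d' i)%N = natcomb d + natcomb d'.
Proof. by apply: ht_inj => i; rewrite htD !ht_natcomb natrD. Qed.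

Lemma natcomb1 i : natcomb (fun j => (j == i) : nat) = row i B.
Proof. by apply: ht_inj => j; rewrite ht_natcomb ht_row. Qed.

(** With [sum_pred], this is the descent step of the inductions on the sum of the coefficients.
    Positivity of [d i] makes the truncated subtraction exact. *)
Lemma natcomb_pred d i : (0 < d i)%N ->
  natcomb d = natcomb (fun j => d j - (j == i))%N + row i B.
Proof.
move=> di; rewrite -natcomb1 -natcombD; apply: natcomb_ext => j /=.
by case: eqP => [->|_]; rewrite ?subnK ?subn0 ?addn0.
Qed.

Lemma sum_pred d i : (0 < d i)%N ->
  (\sum_j (d j - (j == i)) < \sum_j d j)%N.
Proof.
move=> di; rewrite (bigD1 i)//= [X in (_ < X)%N](bigD1 i)//= eqxx.
rewrite (eq_bigr d) => [|j ji]; last by rewrite (negbTE ji) subn0.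
by rewrite ltn_add2r; lia.
Qed.

Lemma dot_natcombl d v : dot (natcomb d) v = \sum_i (d i)%:R * dot (row i B) v.
Proof. by rewrite dot_suml; apply: eq_bigr => i _; rewrite dotZl. Qed.

Lemma cartan_natcombl d v :
  cartan (natcomb d) v = \sum_i (d i)%:R * cartan (row i B) v.
Proof. by rewrite cartan_suml; apply: eq_bigr => i _; rewrite cartanZl. Qed.

Lemma natcomb_eq0 d : natcomb d = 0 -> d =1 (fun => 0%N).
Proof.
move=> d0 i; apply/eqP; rewrite -(pnatr_eq0 R) -ht_natcomb d0.
by rewrite /ht mul0mx mxE.
Qed.

Lemma simple_root i : row i B \in Phi.
Proof. by case: PhiB. Qed.

Let simple_neq0 i : row i B != 0 := root_neq0 PhiRS (simple_root i).

Lemma base_sign a i j : a \in Phi -> 0 < ht B i a -> 0 <= ht B j a.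
Proof.
case: PhiB => _ _ h aP hi; have [_ [//|]] := h a aP.
by move=> /(_ i); rewrite leNgt hi.
Qed.

Lemma pos_natcomb a : a \in Phi -> (forall i, 0 <= ht B i a) ->
  exists d, a = natcomb d.
Proof.
case: PhiB => _ _ h aP apos; have [aint _] := h a aP.
exists (fun i => Num.trunc (ht B i a)); apply: ht_inj => i.
by rewrite ht_natcomb truncnK// natrEint apos is_intRP.
Qed.

(** Otherwise the difference of the two simple roots would be a root with coordinates of both
    signs. *)
Lemma simple_dot_le0 i j : i != j -> dot (row i B) (row j B) <= 0.
Proof.
move=> ij; rewrite leNgt; apply/negP => h.
have P : row i B - row j B \in Phi.
  apply: root_sub => //; try exact: simple_root.
  apply: contra_neq ij => /(congr1 (ht B i)); rewrite !ht_row eqxx.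
  by case: eqP => // _ /eqP; rewrite oner_eq0.
have := @base_sign _ i j P.
rewrite !htD !htN !ht_row !eqxx [j == i]eq_sym (negbTE ij).
by rewrite oppr0 addr0 ltr01 sub0r oppr_ge0 ler10 => /(_ isT).
Qed.

Lemma cartan_natcomb_int d i : cartan (natcomb d) (row i B) \is a Num.int.
Proof.
rewrite cartan_natcombl rpred_sum// => j _; rewrite rpredM ?natr_int//.
exact: (root_int PhiRS (simple_root _) (simple_root _)).
Qed.

(** The squared norm is the sum of the [d i] times these pairings, so some term is positive. This
    selects the simple root to remove in the descents. *)
Lemma exists_dot_gt0 d : natcomb d != 0 ->
  exists2 i, (0 < d i)%N & 0 < dot (natcomb d) (row i B).
Proof.
rewrite -dot_gt0 => h; apply/exists_inP; rewrite -[X in is_true X]negbK.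
rewrite negb_exists_in; apply: contraL h => /forall_inP h; rewrite -leNgt.
rewrite {1}dot_natcombl; apply: sumr_le0 => i _.
have [->|di] := posnP (d i); first by rewrite mul0r.
by rewrite mulr_ge0_le0 ?ler0n// dotC leNgt h.
Qed.

Lemma natcomb_dot_le0 d i : d i = 0%N -> dot (natcomb d) (row i B) <= 0.
Proof.
move=> di; rewrite dot_natcombl; apply: sumr_le0 => j _.
have [->|ji] := eqVneq j i; first by rewrite di mul0r.
by rewrite mulr_ge0_le0 ?ler0n// simple_dot_le0.
Qed.

(** * Comparing a combination with the sum of its support *)

Let supp d i : nat := (0 < d i)%N.

(** Since alpha_i is outside the support, no term of either sum is positive; a zero sum thus makes
    alpha_i orthogonal to every simple root of the support. *)
Lemma supp_dot_eq0 d i : d i = 0%N ->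
  dot (natcomb (supp d)) (row i B) = 0 -> dot (natcomb d) (row i B) = 0.
Proof.
move=> di /eqP; rewrite !dot_natcombl -oppr_eq0 -sumrN psumr_eq0 => [|j _].
  move=> /allP h; apply: big1 => j _; have := h j (mem_index_enum j).
  rewrite /= oppr_eq0 /supp mulf_eq0; case: (d j) => [|k]; rewrite ?mul0r//=.
  by rewrite oner_eq0 => /eqP ->; rewrite mulr0.
have [->|ji] := eqVneq j i; first by rewrite /supp di mul0r oppr0.
by rewrite oppr_ge0 mulr_ge0_le0 ?ler0n// simple_dot_le0.
Qed.

(* Build [natcomb d] by adding simple roots in the reverse order of the
   subtractions below: the norm of the combination never decreases, and the
   norm of the support sum increases by at most as much. *)
Lemma dot_supp_le d :
  dot (natcomb (supp d)) (natcomb (supp d)) <= dot (natcomb d) (natcomb d).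
Proof.
have [N] := ubnP (\sum_j d j)%N; elim: N d => // N IH d dN.
have [d0|d_neq0] := eqVneq (natcomb d) 0.
  rewrite (@natcomb_ext (supp d) d) ?lexx// => i.
  by rewrite /supp (natcomb_eq0 d0).
have [i di ip_gt0] := exists_dot_gt0 d_neq0.
set d1 := fun j => (d j - (j == i))%N.
have dE : natcomb d = natcomb d1 + row i B by apply: natcomb_pred.
have {}IH : dot (natcomb (supp d1)) (natcomb (supp d1))
            <= dot (natcomb d1) (natcomb d1).
  by apply: IH; apply: leq_trans (sum_pred di) _.
have nE : dot (natcomb d) (natcomb d) = dot (natcomb d1) (natcomb d1)
   + (cartan (natcomb d) (row i B) - 1) * dot (row i B) (row i B).
  rewrite mulrBl -dot_cartan// dE !dot_lin (dotC (row i B) (natcomb d1)); ring.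
have r_gt0 : 0 < dot (row i B) (row i B) by rewrite dot_gt0.
have p_ge1 : 1 <= cartan (natcomb d) (row i B).
  by rewrite intr_gt0_ge1 ?cartan_natcomb_int ?cartan_gt0.
(* If [d i] is at least 2, passing from [d1] to [d] keeps the support and does not lower the norm of
   the combination. *)
have [di1|di2] := leqP (d i) 1; last first.
  rewrite (@natcomb_ext (supp d) (supp d1)) => [|j].
    by rewrite (le_trans IH)// nE lerDl mulr_ge0 ?subr_ge0// ltW.
  by rewrite /supp /d1; case: eqP => [->|_]; lia.
have d1i : d1 i = 0%N by rewrite /d1 eqxx; lia.
have gE : natcomb (supp d) = natcomb (supp d1) + row i B.
  rewrite -natcomb1 -natcombD; apply: natcomb_ext => j.
  by rewrite /supp /d1; case: eqP => [->|_]; lia.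
have sE : dot (natcomb (supp d)) (natcomb (supp d))
   = dot (natcomb (supp d1)) (natcomb (supp d1))
   + (cartan (natcomb (supp d1)) (row i B) + 1) * dot (row i B) (row i B).
  rewrite mulrDl -dot_cartan// gE !dot_lin.
  by rewrite (dotC (row i B) (natcomb (supp d1))); ring.
have s_le0 : cartan (natcomb (supp d1)) (row i B) <= 0.
  by rewrite leNgt cartan_gt0// -leNgt natcomb_dot_le0// /supp d1i.
(* If this pairing vanishes, both squared norms grow by exactly that of alpha_i; otherwise the one
   of the support sum does not grow at all. *)
have [s0|s_neq0] := eqVneq (dot (natcomb (supp d1)) (row i B)) 0.
  have p2 : cartan (natcomb d) (row i B) = 2.
    have q0 : cartan (natcomb d1) (row i B) = 0.
      by apply/eqP; rewrite cartan_eq0// supp_dot_eq0.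
    by rewrite dE cartanDl cartan_id// q0 add0r.
  by rewrite sE nE p2; nra.
have : 1 <= - cartan (natcomb (supp d1)) (row i B).
  rewrite intr_gt0_ge1 ?rpredN ?cartan_natcomb_int//.
  by rewrite oppr_gt0 lt_neqAle s_le0 cartan_eq0// s_neq0.
by rewrite sE nE; nra.
Qed.

(* Splitting [d] as its support plus the excess [e], the hypothesis gives
   [dot d e <= 0], so [|supp d|^2 >= |d|^2 + |e|^2], against [dot_supp_le]
   unless [e = 0]. *)
Lemma coef_le1 d :
  (forall i, (1 < d i)%N -> dot (natcomb d) (row i B) <= 0) ->
  forall i, (d i <= 1)%N.
Proof.
move=> dle i; set dd := fun i => (d i).-1.
have dE : natcomb d = natcomb (supp d) + natcomb dd.
  by rewrite -natcombD; apply: natcomb_ext => j; rewrite /supp /dd; case: (d j).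
have : dot (natcomb dd) (natcomb d) <= 0.
  rewrite dot_natcombl; apply: sumr_le0 => j _; rewrite /dd.
  have [dj|/dle dj] := leqP (d j) 1; last by rewrite mulr_ge0_le0 ?ler0n// dotC.
  have -> : (d j).-1 = 0%N by lia.
  by rewrite mul0r.
have := dot_supp_le d.
rewrite dE !dot_lin (dotC (natcomb dd) (natcomb (supp d))) => h1 h2.
have : dot (natcomb dd) (natcomb dd) <= 0 by lra.
rewrite leNgt dot_gt0 negbK => /eqP/natcomb_eq0/(_ i); rewrite /dd; lia.
Qed.

(** * The Dynkin diagram: bonds, connected supports, chordless paths *)

Definition bonded : rel 'I_n := fun i j => dot (row i B) (row j B) != 0.

Lemma bonded_sym : symmetric bonded.
Proof. by move=> i j; rewrite /bonded dotC. Qed.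

Lemma bonded_cartan_leN1 i j : i != j -> bonded i j ->
  cartan (row i B) (row j B) <= -1.
Proof.
rewrite /bonded => ij bij; rewrite lerNr.
rewrite intr_gt0_ge1 ?rpredN ?(root_int PhiRS) ?simple_root//.
by rewrite oppr_gt0 cartan_lt0// lt_neqAle bij simple_dot_le0.
Qed.

Lemma cartan_simple_le0 i j : i != j -> cartan (row i B) (row j B) <= 0.
Proof. by move=> ij; rewrite leNgt cartan_gt0// -leNgt simple_dot_le0. Qed.

(** Subtracting a simple root with positive pairing leaves 0 or a root, whose support is connected
    by induction; it remains to link the removed node [s] to that support. *)
Lemma supp_connected d k l : natcomb d \in Phi -> (0 < d k)%N -> (0 < d l)%N ->
  connect bonded k l.
Proof.
have csym := sym_connect_sym bonded_sym.
have [N] := ubnP (\sum_j d j)%N; elim: N d k l => // N IH d k l dN dP.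
have [s ds ip_gt0] := exists_dot_gt0 (root_neq0 PhiRS dP).
set d1 := fun j => (d j - (j == s))%N.
have dE : natcomb d = natcomb d1 + row s B by apply: natcomb_pred.
have [d1_eq0|d1_neq0] := eqVneq (natcomb d1) 0.
  have ds1 j : (0 < d j)%N -> j = s.
    by have := natcomb_eq0 d1_eq0 j; rewrite /d1; case: eqP => // _; lia.
  by move=> /ds1 -> /ds1 ->; apply: connect0.
have d1P : natcomb d1 \in Phi.
  have -> : natcomb d1 = natcomb d - row s B by rewrite dE addrK.
  apply: root_sub => //; first exact: simple_root.
  apply: contra_neq d1_neq0 => e; apply: (addIr (row s B)).
  by rewrite -dE e add0r.
have {}IH i j : (0 < d1 i)%N -> (0 < d1 j)%N -> connect bonded i j.
  by apply: IH => //; apply: leq_trans (sum_pred ds) _.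
have [t d1t st] : exists2 t, (0 < d1 t)%N & connect bonded s t.
  have [d1s|d1s] := posnP (d1 s); last by exists s.
  apply/exists_inP; rewrite -[X in is_true X]negbK negb_exists_in.
  apply/negP => /forall_inP h.
  (* If alpha_s is outside the support of [d1] and orthogonal to it, reflecting the root in alpha_s
     gives [natcomb d1] minus alpha_s, which has coordinates of both signs. *)
  have ds1 : dot (natcomb d1) (row s B) = 0.
    rewrite dot_natcombl big1// => j _.
    have [->|dj] := posnP (d1 j); first by rewrite mul0r.
    apply/eqP; rewrite mulf_eq0 orbC dotC; apply/orP; left.
    by apply: contraNT (h j dj) => ?; apply: connect1.
  have [j d1j _] := exists_dot_gt0 d1_neq0.
  have := root_refl PhiRS (simple_root s) dP.
  rewrite /refl dE cartanDl cartan_id// {1}/cartan ds1 mulr0 mul0r add0r => rP.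
  have js : j != s by apply: contraTneq d1j => ->; rewrite d1s.
  have := @base_sign _ j s rP.
  rewrite !htD !htN !htZ !ht_row !ht_natcomb eqxx (negbTE js) d1s.
  rewrite mulr0 oppr0 !addr0 add0r ltr0n d1j => /(_ isT).
  by rewrite mulr1 subr_ge0 ler_nat.
have key i : (0 < d i)%N -> connect bonded t i.
  have [->|is_] := eqVneq i s; first by rewrite csym.
  by move=> di; apply: IH => //; rewrite /d1 (negbTE is_) subn0.
by move=> /key tk /key; apply: connect_trans; rewrite csym.
Qed.

End Base.

(** A chord gives a strictly shorter path with the same ends, so induction on the length applies. *)
Lemma chordless_path (T : eqType) (e : rel T) x p0 : path e x p0 ->
  exists p, [/\ path e x p, last x p = last x p0, uniq (x :: p) &
    forall k l, (k.+1 < l <= size p)%N ->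
      ~~ e (nth x (x :: p) k) (nth x (x :: p) l)].
Proof.
have [N] := ubnP (size p0); elim: N p0 => // N IH p0 pN.
case/shortenP => p pp pu psub.
have ps : (size p <= size p0)%N by apply: uniq_leq_size psub; case/andP: pu.
pose f := nth x (x :: p).
case: (boolP [exists k : 'I_(size p).+1, exists l : 'I_(size p).+1,
    (k.+1 < l)%N && e (f k) (f l)]); last first.
  move=> /existsPn h; exists p; split=> // k l /andP[kl lp].
  have kp : (k < (size p).+1)%N by lia.
  have /existsPn/(_ (Ordinal (lp : (l < (size p).+1)%N))) := h (Ordinal kp).
  by rewrite /= kl.
move=> /existsP[k /existsP[[[|l] lp] /andP[/= kl ekl]]]; first by lia.
(* Position [l.+1] of [x :: p] is entry [l] of [p], so following the chord from position [k] keeps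
   [take k p] and [drop l p]. *)
have <- : last x (take k p ++ drop l p) = last x p.
  rewrite last_cat (drop_nth x)//= -[in RHS](cat_take_drop l.+1 p) last_cat.
  by rewrite (take_nth x)// last_rcons.
apply: IH.
- by rewrite size_cat size_take size_drop; case: ifP; lia.
- have lastE a : (a <= size p)%N -> last x (take a p) = f a.
    by move=> ap; rewrite (last_nth x) size_takel//
      -[x :: take a p]/(take a.+1 (x :: p)) nth_take.
  rewrite cat_path take_path// (drop_nth x) ?lastE//=; last by lia.
  have -> : nth x p l = f l.+1 by [].
  rewrite ekl -(lastE l.+1)//.
  by move: pp; rewrite -{1}(cat_take_drop l.+1 p) cat_path => /andP[].
Qed.

(** * The highest root and its half *)

Section HighestRoot.
Set Implicit Arguments.
Unset Strict Implicit.
Variables (R : realType) (n : nat) (Phi : seq 'rV[R]_n) (B : 'M[R]_n).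
Variable (theta : 'rV[R]_n).
Hypotheses (PhiRS : is_root_system Phi) (PhiB : is_base Phi B).
Hypothesis (thetaH : is_highest_root Phi B theta).
Implicit Types (a b v : 'rV[R]_n) (i j : 'I_n) (d g : 'I_n -> nat).

Local Notation "''a_' i" := (row i B) (at level 8, i at level 2).

Let simpleP i : 'a_i \in Phi := simple_root PhiB i.
Let simple_neq0 i : 'a_i != 0 := root_neq0 PhiRS (simpleP i).

Lemma highest_root : theta \in Phi.
Proof. by case: thetaH => -[]. Qed.

Let theta_neq0 : theta != 0 := root_neq0 PhiRS highest_root.

Lemma highest_ge a i : a \in Phi -> ht B i a <= ht B i theta.
Proof.
by case: thetaH => _ h /h/(_ i)[k e]; rewrite -subr_ge0 e ler0n.
Qed.

Lemma highest_coef : exists2 m, theta = natcomb B m & forall i, (0 < m i)%N.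
Proof.
case: thetaH => -[tP tpos] _; have [m mE] := pos_natcomb PhiB tP tpos.
exists m => // i; have := highest_ge i (simpleP i).
by rewrite (ht_row PhiB) eqxx mE (ht_natcomb PhiB) ler1n.
Qed.

(** Otherwise theta + alpha_i would be a root exceeding theta. *)
Lemma highest_dominant i : 0 <= dot 'a_i theta.
Proof.
rewrite leNgt dotC; apply/negP => h.
have [m mE m_gt0] := highest_coef.
have ne : theta != - 'a_i.
  apply/eqP => /(congr1 (ht B i)); rewrite htN (ht_row PhiB) mE (ht_natcomb PhiB).
  rewrite eqxx => e.
  by have : 0 <= (m i)%:R :> R by []; rewrite e oppr_ge0 ler10.
have := highest_ge i (root_add PhiRS highest_root (simpleP i) h ne).
by rewrite htD (ht_row PhiB) eqxx gerDl ler10.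
Qed.

(** Let c be the Cartan number. The negative of the reflection of [a] in theta is the root c theta -
    a; it is at most theta, so [a] is at least (c - 1) theta, hence at least theta. *)
Lemma highest_unique a : a \in Phi -> 2 <= cartan a theta -> a = theta.
Proof.
move=> aP c2; have [m mE m_gt0] := highest_coef.
have rP := root_opp PhiRS (root_refl PhiRS highest_root aP).
apply: (ht_inj PhiB) => i; apply/eqP; rewrite eq_le highest_ge//=.
have := highest_ge i rP; rewrite htN htD htN htZ.
have : 0 <= ht B i theta by rewrite mE (ht_natcomb PhiB).
nra.
Qed.

(* The simple roots along a chordless path from [i] to [j] add up to a root
   whose pairing with the coroot of [theta] is at least 2; hence it is [theta],
   the path exhausts the diagram, and dominance of [theta] forces every bond
   of the path to be simple. *)
Lemma typeA_of_two_ends i j :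
  0 < dot 'a_i theta -> 0 < dot 'a_j theta ->
  (i = j -> 2 <= cartan 'a_i theta) -> typeA B.
Proof.
move=> i_gt0 j_gt0 ij.
have [m mE m_gt0] := highest_coef.
(* The root theta has full support, so the whole diagram is connected. *)
have cij : connect (bonded B) i j.
  by apply: (supp_connected PhiRS PhiB (d := m)) => //; rewrite -mE highest_root.
have [p0 /chordless_path[p [pp pj pu chordless]] jE] := connectP cij.
rewrite -jE in pj.
set N := size p in chordless; pose f := nth i (i :: p).
have bond k : (k < N)%N -> bonded B (f k) (f k.+1) by move/pathP: pp; apply.
have finj k l : (k <= N)%N -> (l <= N)%N -> (f k == f l) = (k == l).
  by move=> kN lN; rewrite nth_uniq.
pose beta K := \sum_(0 <= l < K.+1) 'a_(f l).
have betaP K : (K <= N)%N -> beta K \in Phi.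
  elim: K => [|K IH] KN; first by rewrite /beta big_nat1.
  rewrite /beta big_nat_recr//=; apply: root_add => //.
  - by apply: IH; lia.
  (* By chordlessness only the last summand of [beta K] pairs nontrivially with the next simple
     root. *)
  - rewrite big_nat_recr//= dotDl dot_suml big_nat big1 => [|l lK].
      rewrite add0r lt_neqAle [X in X && _]bond//=.
      by apply: (simple_dot_le0 PhiRS PhiB); rewrite finj; lia.
    by apply/eqP; have := chordless l K.+1; rewrite /bonded negbK; apply; lia.
  - apply/eqP => /(congr1 (ht B (f K.+1))); rewrite htN ht_sum (ht_row PhiB) eqxx.
    rewrite big_nat big1 => [/eqP|l lK]; first by rewrite eq_sym oppr_eq0 oner_eq0.
    by rewrite (ht_row PhiB) finj; [case: eqP => //; lia | lia | lia].
have fN : f N = j by rewrite -pj (last_nth i).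
have thetaE : theta = beta N.
  apply/esym/highest_unique; first exact: betaP.
  have ge1 t : 0 < dot 'a_t theta -> 1 <= cartan 'a_t theta.
    by move=> t0; rewrite intr_gt0_ge1 ?(root_int PhiRS) ?highest_root// cartan_gt0.
  have ge0 t : 0 <= cartan 'a_t theta.
    by rewrite leNgt cartan_lt0// -leNgt highest_dominant.
  rewrite /beta cartan_suml.
  (* A path of length 0 means i = j, where [ij] gives the bound 2; otherwise each end contributes at
     least 1 and the interior is nonnegative. *)
  have [N0|N_gt0] := posnP N.
    by rewrite N0 big_nat1 ij// -fN N0.
  rewrite big_nat_recr//= big_ltn// fN.
  have := ge1 i i_gt0; have := ge1 j j_gt0.
  have : 0 <= \sum_(1 <= l < N) cartan 'a_(f l) theta by apply: sumr_ge0.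
  rewrite {2}/f /=; lra.
(* Full support of theta forces the path through every node, so its positions enumerate the base. *)
have all_p t : t \in i :: p.
  have := m_gt0 t; rewrite -(ltr0n R) -(ht_natcomb PhiB) -mE thetaE ht_sum.
  apply: contraTT => tp; rewrite big_nat big1 ?ltxx// => l lN.
  rewrite (ht_row PhiB); case: eqP => // te; move: tp.
  by rewrite te mem_nth//; lia.
have nN : n = N.+1.
  rewrite -[LHS]card_ord -[RHS]/(size (i :: p)) -(card_uniqP pu).
  by apply: eq_card => t; rewrite all_p.
pose C k l := cartan 'a_(f k) 'a_(f l).
have Cle0 k l : (k <= N)%N -> (l <= N)%N -> k != l -> C k l <= 0.
  by move=> kN lN kl; apply: (cartan_simple_le0 PhiRS PhiB); rewrite finj.
have CleN1 k l : (k <= N)%N -> (l <= N)%N -> k.+1 = l \/ l.+1 = k -> C k l <= -1.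
  move=> kN lN kl; apply: (bonded_cartan_leN1 PhiRS PhiB); first by rewrite finj; lia.
  by case: kl => kl; [rewrite -kl | rewrite -kl bonded_sym]; apply: bond; lia.
have thetaC l : cartan theta 'a_(f l) = \sum_(k < N.+1) C k l.
  by rewrite thetaE cartan_suml big_mkord.
have CN1 k l : (k <= N)%N -> (l <= N)%N -> k.+1 = l \/ l.+1 = k -> C k l = -1.
  move=> kN lN kl; apply/eqP; rewrite eq_le CleN1//=.
  rewrite leNgt; apply/negP => Clt.
  have C2 : C k l <= -2.
    have : 1 <= - 1 - C k l.
      rewrite intr_gt0_ge1 ?subr_gt0// rpredB ?rpredN ?rpred1//.
      exact: (root_int PhiRS).
    by lra.
  have [kN' lN'] : (k < N.+1)%N /\ (l < N.+1)%N by [].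
  have := thetaC l; rewrite (bigD1 (Ordinal lN'))//= (bigD1 (Ordinal kN'))/=; last first.
    by clear -kl; apply/eqP => -[]; lia.
  have -> : C l l = 2 by apply: cartan_id.
  have rest_le0 (P : pred 'I_N.+1) : (forall t, P t -> t != Ordinal lN') ->
      \sum_(t < N.+1 | P t) C t l <= 0.
    by move=> Pl; apply: sumr_le0 => t /Pl tl; apply: Cle0 => //; rewrite -ltnS.
  (* The pairing of theta with the coroot of [f l] is 2 plus nonpositive terms, one of them now at
     most -2. At an end it must be positive; at an interior node the other neighbour makes it
     negative, against dominance. *)
  have [lend|lmid] := boolP ((l == 0%N) || (l == N)).
    have : 0 < cartan theta 'a_(f l).
      by rewrite cartan_gt0// dotC; case/orP: lend => /eqP ->; rewrite ?fN.
    set S := \sum_(t < _ | _) _.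
    have : S <= 0 by apply: rest_le0 => t /andP[].
    by lra.
  have [k' [k'N k'l k'k]] :
      exists k', [/\ (k' < N.+1)%N, k'.+1 = l \/ l.+1 = k' & k' != k].
    by clear -kl lmid kN' lN'; case: kl => ?; [exists l.+1 | exists l.-1]; split; lia.
  rewrite (bigD1 (Ordinal k'N))/=; last first.
    by clear -k'k k'l; apply/andP; split; apply/eqP => -[]; lia.
  have : 0 <= cartan theta 'a_(f l).
    by rewrite leNgt cartan_lt0// -leNgt dotC highest_dominant.
  have := CleN1 k' l k'N lN k'l.
  set S := \sum_(t < _ | _) _.
  have : S <= 0 by apply: rest_le0 => t /andP[/andP[]].
  by lra.
have ltN (k : 'I_n) : (k <= N)%N by rewrite -ltnS -nN.
have ginj : injective (fun k : 'I_n => f k).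
  by move=> k l /eqP; rewrite finj// => /eqP/val_inj.
exists (perm ginj) => k l; rewrite !permE -/(C k l).
have [->|kl] := eqVneq k l; first exact: cartan_id.
case: ifP => [adj|nadj]; first by apply: CN1 => //; lia.
apply/eqP; rewrite cartan_eq0//.
have kl' : nat_of_ord k != l by [].
have [ltkl|ltlk] := ltnP k l.
  by have := chordless k l; rewrite /bonded negbK; apply; have := ltN l; lia.
by rewrite dotC; have := chordless l k; rewrite /bonded negbK; apply; have := ltN k; lia.
Qed.

(** The products m_i c_i are nonnegative integers with sum 2. A node with c_i positive and m_i at
    least 2 uses up the whole sum. Without such a node, either some c_i is at least 2 or two nodes
    have positive c_i, and [typeA_of_two_ends] applies. *)
Lemma not_typeA_node m : ~ typeA B -> theta = natcomb B m ->
  exists i, [/\ 0 < dot 'a_i theta, m i = 2%N &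
    forall j, j != i -> dot 'a_j theta = 0].
Proof.
move=> nA mE; pose c i := cartan 'a_i theta.
have m_ge1 i : 1 <= (m i)%:R :> R.
  have [m' m'E m'_gt0] := highest_coef.
  by rewrite -(ht_natcomb PhiB) -mE m'E (ht_natcomb PhiB) ler1n.
have c_ge0 i : 0 <= c i by rewrite leNgt cartan_lt0// -leNgt highest_dominant.
have c_ge1 i : 0 < c i -> 1 <= c i.
  exact/intr_gt0_ge1/(root_int PhiRS highest_root (simpleP i)).
have mc_ge0 i : 0 <= (m i)%:R * c i by rewrite mulr_ge0.
have mc_sum : \sum_i (m i)%:R * c i = 2.
  by rewrite -cartan_natcombl -mE cartan_id.
case: (boolP [exists i, (0 < c i) && (1 < m i)%N]) => [/existsP[i]|/existsPn h].
  move=> /andP[ci mi]; exists i.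
  move: mc_sum; rewrite (bigD1 i)//= => mc_sum.
  have rest_ge0 (P : pred 'I_n) : 0 <= \sum_(j | P j) (m j)%:R * c j.
    by apply: sumr_ge0.
  have := c_ge1 i ci; have := rest_ge0 (fun j => j != i).
  have mi2 : 2 <= (m i)%:R :> R by rewrite ler_nat.
  split=> [||j ji]; first by rewrite -cartan_gt0.
    apply/eqP; rewrite eqn_leq mi andbT leqNgt; apply/negP => mi3.
    have : 3 <= (m i)%:R :> R by rewrite ler_nat.
    nra.
  move: mc_sum; rewrite (bigD1 j)//=; set S := \sum_(k | _) _.
  have S_ge0 : 0 <= S by apply: rest_ge0.
  have := m_ge1 j; have := c_ge0 j => *.
  apply/eqP; rewrite -cartan_eq0// eq_le -/(c j) c_ge0 andbT.
  by nra.
have m1 i : 0 < c i -> (m i)%:R = 1 :> R.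
  move=> ci; have := h i; rewrite ci /= -leqNgt => mi.
  by apply/eqP; rewrite eq_le m_ge1 lern1 mi.
have [i /andP[_ mci]] : exists i, true && (0 < (m i)%:R * c i).
  by apply: psumr_neq0P => //; rewrite mc_sum; apply/eqP; rewrite pnatr_eq0.
have ci : 0 < c i.
  by rewrite lt_neqAle c_ge0 andbT; apply: contraTneq mci => <-; rewrite mulr0 ltxx.
case: nA; have i_gt0 : 0 < dot 'a_i theta by rewrite -cartan_gt0.
have [c2|c2] := leP 2 (c i); first exact: (@typeA_of_two_ends i i).
have [j /andP[ji mcj]] : exists j, (j != i) && (0 < (m j)%:R * c j).
  apply: psumr_neq0P => // e; move: mc_sum.
  by rewrite (bigD1 i)//= e m1// mul1r addr0 => e2; rewrite e2 ltxx in c2.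
apply: (@typeA_of_two_ends i j) => // [|ij]; last by rewrite ij eqxx in ji.
rewrite -cartan_gt0// lt_neqAle c_ge0 andbT.
by apply: contraTneq mcj => e; rewrite -[cartan _ _]/(c j) in e; rewrite -e mulr0 ltxx.
Qed.

(* Climb from the simple root of [i0] through roots [g] with [2 g] below
   [theta]; when no step is possible, [coef_le1] applies to [theta - 2 g]. *)
Lemma half_is_root m i0 : theta = natcomb B m -> m i0 = 2%N ->
  (forall j, j != i0 -> dot 'a_j theta = 0) ->
  natcomb B (fun i => (m i)./2) \in Phi.
Proof.
move=> mE mi0 orth.
suff climb g : natcomb B g \in Phi -> (forall i, (g i).*2 <= m i)%N ->
    (0 < g i0)%N -> natcomb B (fun i => (m i)./2) \in Phi.
  have [m' m'E m'_gt0] := highest_coef.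
  (* The climb can start at alpha_i0 because m_i0 = 2 and all other coefficients of theta are
     nonnegative. *)
  apply: (climb (fun j => (j == i0) : nat)); rewrite ?(natcomb1 PhiB) ?eqxx//.
  by move=> i; case: eqP => [->|_//]; rewrite mi0.
have [N] := ubnP (\sum_i (m i - g i))%N.
elim: N g => // N IH g gN gP gm gi0.
case: (boolP [exists i, ((g i).+1.*2 <= m i)%N && (dot (natcomb B g) 'a_i < 0)]).
  move=> /existsP[i /andP[gi ip_lt0]].
  pose g' j := (g j + (j == i))%N.
  have g'E : natcomb B g' = natcomb B g + 'a_i.
    by rewrite (natcombD PhiB) (natcomb1 PhiB).
  apply: (IH g').
  - rewrite ltnS in gN; apply: leq_trans gN.
    rewrite (bigD1 i)//= [X in (_ <= X)%N](bigD1 i)//=.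
    rewrite /g' eqxx; have -> : \sum_(j < n | j != i) (m j - (g j + (j == i)))%N =
        \sum_(j < n | j != i) (m j - g j)%N.
      by apply: eq_bigr => j /negbTE ->; rewrite addn0.
    by rewrite -[X in (X <= _)%N]addSn leq_add2r; lia.
  - rewrite g'E root_add//; apply/eqP => /(congr1 (ht B i)).
    rewrite htN (ht_row PhiB) eqxx (ht_natcomb PhiB) => e.
    by have : 0 <= (g i)%:R :> R by []; rewrite e oppr_ge0 ler10.
  - by move=> j; rewrite /g'; case: eqP => [->|_]; rewrite ?addn0// addn1.
  - by rewrite /g'; lia.
move=> /existsPn stuck.
pose d i := (m i - (g i).*2)%N.
have dE : natcomb B d = theta - 2 *: natcomb B g.
  apply: (ht_inj PhiB) => i; rewrite mE htD htN htZ !(ht_natcomb PhiB).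
  by rewrite /d natrB// -muln2 natrM mulrC.
have d_le1 i : (d i <= 1)%N.
  apply: (coef_le1 PhiRS PhiB) => {}i di.
  (* As m_i0 = 2 and [g i0] is positive, [d i0] is 0. So alpha_i is orthogonal to theta, and its
     pairing with theta - 2g is -2 times its pairing with g, which is nonnegative since the climb is
     stuck. *)
  have ii0 : i != i0 by apply: contraTneq di => ->; rewrite /d mi0; lia.
  have : 0 <= dot (natcomb B g) 'a_i.
    have := stuck i; rewrite negb_and -leNgt => /orP[|//].
    by move: di; rewrite /d; lia.
  rewrite dE dotDl dotNl dotZl (dotC theta) orth//; lra.
rewrite (@natcomb_ext _ _ B _ g)// => i.
by have := d_le1 i; have := gm i; rewrite /d; lia.
Qed.

End HighestRoot.

(** * From the half of theta to the maximum of the non-abelian roots *)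

Theorem theorem3p5 (R : realType) (n : nat) (Phi : seq 'rV[R]_n)
  (B : 'M[R]_n) (theta : 'rV[R]_n) :
  is_root_system Phi -> is_reduced Phi -> is_irreducible Phi ->
  is_base Phi B -> is_highest_root Phi B theta ->
  ~ typeA B ->
  let mu := half_floor B theta in
  [/\ mu \in Phi,
      nc_root Phi B mu,
      (forall g, nc_root Phi B g -> preceq B mu g -> g = mu),
      (forall g, nc_root Phi B g ->
         (forall g', nc_root Phi B g' -> preceq B g g' -> g' = g) -> g = mu) &
      heis Phi B theta mu].

Proof.
move=> PhiRS _ _ PhiB thetaH nA mu.
have thetaP := highest_root thetaH.
have [m mE m_gt0] := highest_coef PhiB thetaH.
have [i0 [i0_gt0 mi0 orth]] := not_typeA_node PhiRS PhiB thetaH nA mE.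
have ht_theta i : ht B i theta = (m i)%:R by rewrite mE (ht_natcomb PhiB).
have muE : mu = natcomb B (fun i => (m i)./2).
  apply: eq_bigr => i _; congr (_ *: _); rewrite ht_theta.
  rewrite (@floor_def _ _ ((m i)./2 : int))//.
  have := congr1 (fun k : nat => k%:R : R) (odd_double_half (m i)).
  rewrite natrD -muln2 natrM intrD -!pmulrn; case: (odd (m i)) => /= e; lra.
have ht_mu i : ht B i mu = ((m i)./2)%:R by rewrite muE (ht_natcomb PhiB).
have muP : mu \in Phi by rewrite muE (half_is_root PhiRS PhiB thetaH mE mi0).
have mu_pos : pos_root Phi B mu by split=> // i; rewrite ht_mu.
have mu_theta : 0 < dot mu theta.
  (* Only alpha_i0 pairs nontrivially with theta, and its coefficient in [mu] is 2/2 = 1. *)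
  rewrite muE dot_natcombl (bigD1 i0)//= mi0 mul1r ltr_wpDr//.
  by apply: sumr_ge0 => i /orth ->; rewrite mulr0.
have mu_neq : theta != mu.
  apply/eqP => /(congr1 (ht B i0)); rewrite ht_theta ht_mu mi0 => /eqP.
  by rewrite eqr_nat.
have theta_mu : theta - mu \in Phi by apply: root_sub; rewrite // dotC.
have ht_diff i : ht B i (theta - mu) = (m i - (m i)./2)%:R.
  by rewrite htD htN ht_theta ht_mu natrB//; lia.
(* The pair [mu], [theta - mu] has sum theta; the second lies above [mu] since its coefficients are
   the halves rounded up. *)
have mu_nc : nc_root Phi B mu.
  split=> // /(_ mu (theta - mu)); apply.
  - by split=> // i; exists 0%N; rewrite subrr.
  - split; first by split=> // i; rewrite ht_diff.
    move=> i; exists (m i - (m i)./2 - (m i)./2)%N.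
    by rewrite ht_diff ht_mu -natrB//; lia.
  - by rewrite addrC subrK; case: thetaH.
have nc_le g : nc_root Phi B g -> preceq B g mu.
  move=> [[gP gpos] nab].
  have [k gE] := pos_natcomb PhiB gP gpos.
  have ht_g i : ht B i g = (k i)%:R by rewrite gE (ht_natcomb PhiB).
  suff k_le i : ((k i).*2 <= m i)%N.
    by move=> i; exists ((m i)./2 - k i)%N; rewrite ht_mu ht_g natrB//; have := k_le i; lia.
  (* If 2 k_i exceeds m_i, the sum of two roots above [g] exceeds theta at i, so it is not a root
     and the ideal is abelian. *)
  rewrite leqNgt; apply/negP => mk; apply: nab => a b [_ ga] [_ gb] [abP _].
  have := highest_ge thetaH i abP; rewrite htD ht_theta.
  have [p pE] := ga i; have [q qE] := gb i.
  have -> : ht B i a = (k i + p)%:R by rewrite natrD -pE ht_g; ring.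
  have -> : ht B i b = (k i + q)%:R by rewrite natrD -qE ht_g; ring.
  by rewrite -natrD ler_nat; lia.
have anti u v : preceq B u v -> preceq B v u -> u = v.
  move=> uv vu; apply: (ht_inj PhiB) => i; apply/eqP.
  have [p pE] := uv i; have [q qE] := vu i.
  by rewrite eq_le; apply/andP; split; rewrite -subr_ge0 ?pE ?qE ler0n.
(* Since [mu] is a maximum, both its maximality and its uniqueness follow from [nc_le]. *)
split=> // g gnc.
- by move=> mug; apply: anti mug; apply: nc_le.
- by move=> gmax; apply/esym/gmax => //; apply: nc_le.
Qed.
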